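(* Let $\mathbf w$ and $\mathbf w'$ be the entropy balancing weights (EBW) for datasets $\mathcal D$ and $\mathcal D'$ of size $n$ that differ at one point, with dual variables restricted to the ball $\|\boldsymbol\lambda\|_2\le R_{\mathrm{EBW}}$. Let $\mathbf B\in\mathbb R^{n\times2(K+1)}$ be the extended covariate matrix of $\mathcal D$ with rows $$\mathbf b_i:=\frac n{n_0}\begin{pmatrix}\mathbf g(\mathbf x_i)\\ \mathbf 0\end{pmatrix}\ \text{if }a_i=0,\qquad\mathbf b_i:=\frac n{n_1}\begin{pmatrix}\mathbf 0\\ \mathbf g(\mathbf x_i)\end{pmatrix}\ \text{if }a_i=1,$$ and suppose $\|\mathbf b_i\|_2\le1$ for all $i$ (for the rows formed from $\mathcal D$ and likewise those formed from $\mathcal D'$). Let $\hat\Sigma\in\mathbb R^{2(K+1)\times2(K+1)}$ be the empirical covariance matrix of $\mathbf B$. Define $r_q:=\max_iq_i/\min_iq_i\ge1$, $$\rho:=r_q^{-1}\exp(-2R_{\mathrm{EBW}})\lambda_{\min}(\hat\Sigma)+\lambda_{\mathrm{EBW}},\qquad\delta_E:=R_{\mathrm{EBW}}\wedge\frac{1+\sqrt2}\rho,$$ and suppose $\rho>0$. Then $$\|\mathbf w-\mathbf w'\|_2\le\frac{2\,r_q\exp(2R_{\mathrm{EBW}})\big(\sqrt2+r_q\exp(2R_{\mathrm{EBW}})\big)}{\rho\sqrt n}+\frac{2R_{\mathrm{EBW}}\,r_q^2\exp(4R_{\mathrm{EBW}})}{\rho}+2\sqrt2\,r_q\,\delta_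E\exp(2\delta_E).$$
   Context: $a\wedge b=\min\{a,b\}$; $\lambda_{\min}$ is the smallest eigenvalue. A dataset is $\mathcal D=(\mathbf x_i,a_i)_{i=1}^n$, $\mathbf x_i\in\mathbb R^p$, $a_i\in\{0,1\}$, and $n_a=\#\{i:a_i=a\}\ge1$ for $a=0,1$ (computed from the dataset in question). $\mathbf g=(g_0,\dots,g_K):\mathbb R^p\to\mathbb R^{K+1}$ is a fixed vector of balance functions, $g_0$ being the constant (zeroth moment) function, up to the overall positive rescaling of $\mathbf g$ used to normalize $\|\mathbf b_i\|_2\le1$. $\mathbf q=(q_1,\dots,q_n)$ is a fixed base probability vector with positive entries, the same for both datasets, and $\lambda_{\mathrm{EBW}}\ge0$. The empirical covariance is $\hat\Sigma=\frac1n\sum_i(\mathbf b_i-\bar{\mathbf b})(\mathbf b_i-\bar{\mathbf b})^\top$ with $\bar{\mathbf b}=\frac1n\sum_i\mathbf b_i$. Entropy balancing weights: with $\overline{\mathbf g}=\frac1n\sum_{i=1}^n\mathbf g(\mathbf x_i)$, $\boldsymbol\lambda=(\boldsymbol\lambda_0,\boldsymbol\lambda_1)\in\mathbb R^{K+1}\times\mathbb R^{K+1}$ and $C(\boldsymbol\lambda)=\sum_{i=1}^nq_i\exp\big(\frac n{n_{a_i}}\langle\boldsymbol\lambda_{a_i},\mathbf g(\mathbf x_i)\rangle\big)$, let $$\hat{\boldsymbol\lambda}=\arg\max_{\|\boldsymbol\lambda\|_2\le R_{\mathrm{EBW}}}\Big[\langle\boldsymbol\lambda_0+\boldsymbol\lambda_1,\overline{\mathbf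 g}\rangle-\log C(\boldsymbol\lambda)-\frac{\lambda_{\mathrm{EBW}}}2\|\boldsymbol\lambda\|_2^2\Big],\qquad w_i=\frac n{C(\hat{\boldsymbol\lambda})}\,q_i\exp\Big(\frac n{n_{a_i}}\langle\hat{\boldsymbol\lambda}_{a_i},\mathbf g(\mathbf x_i)\rangle\Big).$$ $\mathbf w'$ is obtained in the same way from $\mathcal D'$. *)

(* Defs.v *)
From mathcomp Require Import all_boot all_order all_algebra.
From mathcomp Require Import all_classical all_reals all_analysis.

Set Implicit Arguments.
Unset Strict Implicit.
Unset Printing Implicit Defensive.
Import Order.TTheory GRing.Theory Num.Theory.

Local Open Scope classical_set_scope.
Local Open Scope ring_scope.

Definition dotp (R : realType) m (u v : 'rV[R]_m) : R :=
  \sum_(j < m) u ord0 j * v ord0 j.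

(* The norm that MathComp-Analysis puts on matrices is the sup norm. *)
Definition l2norm (R : realType) m (u : 'rV[R]_m) : R := Num.sqrt (dotp u u).

(* For a symmetric real S (n > 0) the set of eigenvalues is finite and
   nonempty, so this infimum is the smallest eigenvalue. *)
Definition lambda_min (R : realType) m (S : 'M[R]_m) : R :=
  inf [set l : R | eigenvalue S l].

Definition rows_mean (R : realType) n m (B : 'M[R]_(n, m)) : 'rV[R]_m :=
  n%:R^-1 *: \sum_(i < n) row i B.

Definition empirical_cov (R : realType) n m (B : 'M[R]_(n, m)) : 'M[R]_m :=
  n%:R^-1 *: \sum_(i < n) (row i B - rows_mean B)^T *m (row i B - rows_mean B).

(* The i-th point is (x_i, a_i), with the arm a_i = 1 encoded as true. *)
Definition dataset (R : realType) n p := 'I_n -> 'rV[R]_p * bool.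

Definition arm_size (R : realType) n p (D : dataset R n p) (a : bool) : nat :=
  #|[pred i | (D i).2 == a]|.

(* Datasets are ordered (the i-th point carries the base weight q_i), so
   neighbours agree at every index except possibly one; both the covariates
   and the arm of that point may change. *)
Definition differ_at_one_point (R : realType) n p (D D' : dataset R n p) : Prop :=
  exists k : 'I_n, forall i : 'I_n, i != k -> D i = D' i.

(* g = (g_0, ..., g_K) with g_0 = 1 up to a common positive rescaling of g. *)
Definition constant_zeroth_moment (R : realType) p K
    (g : 'rV[R]_p -> 'rV[R]_K.+1) : Prop :=
  exists2 s : R, 0 < s & forall x, g x ord0 ord0 = s.

Definition probability_vector (R : realType) n (q : 'I_n -> R) : Prop :=
  (forall i, 0 < q i) /\ \sum_(i < n) q i = 1.

(* The initial values 0 and 1 are neutral, as 0 < q_i <= 1 for all i. *)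
Definition max_min_ratio (R : realType) n (q : 'I_n -> R) : R :=
  (\big[Num.max/0]_(i < n) q i) / (\big[Num.min/1]_(i < n) q i).

Section EntropyBalancing.
Variables (R : realType) (n p K : nat).
Variables (g : 'rV[R]_p -> 'rV[R]_K.+1) (q : 'I_n -> R).
Variables (RE lamE : R) (D : dataset R n p).

(* Embedding of R^{K+1} as the block of arm a in R^{2(K+1)}. *)
Definition arm_embed (a : bool) (v : 'rV[R]_K.+1) : 'rV[R]_(K.+1 + K.+1) :=
  if a then row_mx 0 v else row_mx v 0.

Definition arm_part (a : bool) (lam : 'rV[R]_(K.+1 + K.+1)) : 'rV[R]_K.+1 :=
  if a then rsubmx lam else lsubmx lam.

Definition arm_scale (i : 'I_n) : R := n%:R / (arm_size D (D i).2)%:R.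

Definition ext_row (i : 'I_n) : 'rV[R]_(K.+1 + K.+1) :=
  arm_scale i *: arm_embed (D i).2 (g (D i).1).

Definition ext_mx : 'M[R]_(n, K.+1 + K.+1) := \matrix_(i < n) ext_row i.

Definition g_mean : 'rV[R]_K.+1 := n%:R^-1 *: \sum_(i < n) g (D i).1.

Definition tilt (lam : 'rV[R]_(K.+1 + K.+1)) (i : 'I_n) : R :=
  q i * expR (arm_scale i * dotp (arm_part (D i).2 lam) (g (D i).1)).

Definition ebw_C (lam : 'rV[R]_(K.+1 + K.+1)) : R := \sum_(i < n) tilt lam i.

Definition ebw_objective (lam : 'rV[R]_(K.+1 + K.+1)) : R :=
  dotp (arm_part false lam + arm_part true lam) g_mean
  - ln (ebw_C lam) - lamE / 2 * l2norm lam ^+ 2.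

Definition ebw_argmax (lam : 'rV[R]_(K.+1 + K.+1)) : Prop :=
  l2norm lam <= RE /\
  forall mu, l2norm mu <= RE -> ebw_objective mu <= ebw_objective lam.

Definition ebw_weights (lam : 'rV[R]_(K.+1 + K.+1)) : 'rV[R]_n :=
  \row_(i < n) (n%:R / ebw_C lam * tilt lam i).

End EntropyBalancing.

(* Main.v *)
(** A change of the dual variable or of the data tilts the exponents of the
    Gibbs weights [p_i] proportional to [q_i exp x_i] along a segment, and the
    derivative of a Gibbs mean along a segment is a Gibbs covariance; all the
    estimates below come from the mean value theorem and Cauchy-Schwarz for
    that covariance.

    Since [p_i] is at least [exp (-2 R) / (r_q n)] on the ball, the Gibbs
    covariance of the rows dominates the empirical one, which makes the dual
    [rho]-strongly concave for [D]; hence [|lam| <= deltaE], and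
    [|lam - lam'| <= G / rho] with [G] the gap at [lam'] between the gradients
    of the two duals.  With [b_i], [b'_i] the rows of [D], [D'] and
    [M = r_q exp (2 R)], the gap [G] is at most
    [2 sqrt M (sqrt 2 + M) / n + 2 R sqrt (M / n)].  If the changed point
    moves to the other arm, every row is rescaled, but the rescalings in one
    arm add up to at most one unit, so that still
    [sum_i |b_i - b'_i| <= 2 + sqrt 2] and [sum_i |b_i - b'_i|^2 <= 4].

    Finally the weights pass from [(D, lam)] to [(D', lam)] at cost
    [2 deltaE r_q exp (2 deltaE)] and from there to [(D', lam')] at cost
    [sqrt (n M) |lam - lam'|]. *)

Require Import Defs.
From mathcomp Require Import all_boot all_order all_algebra.
From mathcomp Require Import all_classical all_reals all_analysis.
From mathcomp Require Import zify ring lra.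

Set Implicit Arguments.
Unset Strict Implicit.
Unset Printing Implicit Defensive.

Import Order.TTheory GRing.Theory Num.Theory.
Import numFieldNormedType.Exports.
Local Open Scope ring_scope.

(** * The Euclidean structure on row vectors *)

(** The nonnegative sum of [p i * (C * f i - B * g i) ^+ 2] equals [C * (A * C - B ^+ 2)]. For
    [C = 0] this says nothing, but then every [p i * g i ^+ 2] vanishes, and [B] with it. *)
Lemma weighted_cauchy_schwarz (R : realFieldType) (I : finType) (p f g : I -> R)
    (p_ge0 : forall i, 0 <= p i) :
  (\sum_i p i * (f i * g i)) ^+ 2 <=
    (\sum_i p i * f i ^+ 2) * (\sum_i p i * g i ^+ 2).
Proof.
set A := \sum_i p i * f i ^+ 2; set B := \sum_i _; set C := \sum_i p i * g i ^+ 2.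
have C_ge0 : 0 <= C by apply: sumr_ge0 => i _; rewrite mulr_ge0 ?sqr_ge0.
have [C0|Cn0] := eqVneq C 0.
  have B0 : B = 0.
    apply: big1 => i _.
    have /eqP := C0; rewrite psumr_eq0 => [/allP/(_ i)|j _]; last first.
      by rewrite mulr_ge0 ?sqr_ge0.
    rewrite mem_index_enum => /(_ isT); rewrite mulf_eq0 sqrf_eq0.
    by case/orP => /eqP ->; rewrite ?mulr0 ?mul0r.
  by rewrite B0 C0 mulr0 expr0n.
have C_gt0 : 0 < C by rewrite lt_def Cn0.
have : 0 <= \sum_i p i * (C * f i - B * g i) ^+ 2.
  by apply: sumr_ge0 => i _; rewrite mulr_ge0 ?sqr_ge0.
have -> : \sum_i p i * (C * f i - B * g i) ^+ 2 = C * (A * C - B ^+ 2).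
  transitivity (\sum_i (C ^+ 2 * (p i * f i ^+ 2)
      + - (2 * C * B) * (p i * (f i * g i)) + B ^+ 2 * (p i * g i ^+ 2))).
    by apply: eq_bigr => i _; ring.
  by rewrite !big_split -!mulr_sumr -/A -/B -/C /=; ring.
by rewrite pmulr_rge0 // subr_ge0.
Qed.

Section Dot.
Variables (R : realType) (m : nat).
Implicit Types u v w : 'rV[R]_m.

Lemma dotpC u v : dotp u v = dotp v u.
Proof. by apply: eq_bigr => j _; rewrite mulrC. Qed.

Lemma dotpDl u v w : dotp (u + v) w = dotp u w + dotp v w.
Proof. by rewrite -big_split; apply: eq_bigr => j _; rewrite mxE mulrDl. Qed.

Lemma dotpZl a u v : dotp (a *: u) v = a * dotp u v.
Proof. by rewrite mulr_sumr; apply: eq_bigr => j _; rewrite mxE mulrA. Qed.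

Lemma dotpNl u v : dotp (- u) v = - dotp u v.
Proof. by rewrite -scaleN1r dotpZl mulN1r. Qed.

Lemma dotpBl u v w : dotp (u - v) w = dotp u w - dotp v w.
Proof. by rewrite dotpDl dotpNl. Qed.

Lemma dotp0l u : dotp 0 u = 0.
Proof. by rewrite -(scale0r u) dotpZl mul0r. Qed.

Lemma dotp0r u : dotp u 0 = 0.
Proof. by rewrite dotpC dotp0l. Qed.

Lemma dotpDr u v w : dotp w (u + v) = dotp w u + dotp w v.
Proof. by rewrite dotpC dotpDl !(dotpC w). Qed.

Lemma dotpZr a u v : dotp v (a *: u) = a * dotp v u.
Proof. by rewrite dotpC dotpZl dotpC. Qed.

Lemma dotpBr u v w : dotp w (u - v) = dotp w u - dotp w v.
Proof. by rewrite dotpC dotpBl !(dotpC w). Qed.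

Lemma dotpNr u v : dotp v (- u) = - dotp v u.
Proof. by rewrite dotpC dotpNl dotpC. Qed.

Lemma dotp_sumr (I : finType) u (F : I -> 'rV[R]_m) :
  dotp u (\sum_i F i) = \sum_i dotp u (F i).
Proof.
rewrite exchange_big; apply: eq_bigr => j _.
by rewrite summxE mulr_sumr.
Qed.

Lemma dotp_ge0 u : 0 <= dotp u u.
Proof. by apply: sumr_ge0 => j _; rewrite -expr2 sqr_ge0. Qed.

Lemma dotp_eq0 u : (dotp u u == 0) = (u == 0).
Proof.
apply/idP/eqP => [|->]; last by rewrite dotp0l.
rewrite psumr_eq0 => [/allP u0|j _]; last by rewrite -expr2 sqr_ge0.
apply/rowP => j; rewrite mxE; apply/eqP.
by have := u0 j; rewrite mem_index_enum -expr2 sqrf_eq0; apply.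
Qed.

Lemma l2norm_ge0 u : 0 <= l2norm u. Proof. exact: sqrtr_ge0. Qed.

Lemma sqr_l2norm u : l2norm u ^+ 2 = dotp u u.
Proof. by rewrite sqr_sqrtr // dotp_ge0. Qed.

Lemma sqr_dotp_le u v : dotp u v ^+ 2 <= dotp u u * dotp v v.
Proof.
have := @weighted_cauchy_schwarz R _ (fun=> 1) (u ord0) (v ord0) (fun=> ler01).
under eq_bigr do rewrite mul1r.
under [X in _ <= X * _ -> _]eq_bigr do rewrite mul1r expr2.
by under [X in _ <= _ * X -> _]eq_bigr do rewrite mul1r expr2.
Qed.

Lemma normr_dotp_le u v : `|dotp u v| <= l2norm u * l2norm v.
Proof.
rewrite -(@ler_pXn2r _ 2) ?nnegrE ?mulr_ge0 ?l2norm_ge0 //.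
by rewrite exprMn !sqr_l2norm real_normK ?num_real ?sqr_dotp_le.
Qed.

Lemma dotp_le u v : dotp u v <= l2norm u * l2norm v.
Proof. exact: le_trans (ler_norm _) (normr_dotp_le u v). Qed.

Lemma l2normD u v : l2norm (u + v) <= l2norm u + l2norm v.
Proof.
rewrite -(@ler_pXn2r _ 2) ?nnegrE ?addr_ge0 ?l2norm_ge0 //.
rewrite sqr_l2norm dotpDl !dotpDr sqrrD !sqr_l2norm (dotpC v u).
by have := dotp_le u v; lra.
Qed.

Lemma l2normZ a u : l2norm (a *: u) = `|a| * l2norm u.
Proof.
by rewrite /l2norm dotpZl dotpZr mulrA -expr2 sqrtrM ?sqr_ge0 // sqrtr_sqr.
Qed.

Lemma l2normN u : l2norm (- u) = l2norm u.
Proof. by rewrite -scaleN1r l2normZ normrN1 mul1r. Qed.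

Lemma l2normB u v : l2norm (u - v) <= l2norm u + l2norm v.
Proof. by rewrite -(l2normN v) l2normD. Qed.

Lemma l2norm0 : l2norm (0 : 'rV[R]_m) = 0.
Proof. by rewrite /l2norm dotp0l sqrtr0. Qed.

Lemma l2norm_sum (I : finType) (F : I -> 'rV[R]_m) :
  l2norm (\sum_i F i) <= \sum_i l2norm (F i).
Proof.
elim/big_rec2: _ => [|i x y _ le_yx]; first by rewrite l2norm0.
by rewrite (le_trans (l2normD _ _)) // lerD2l.
Qed.

Lemma dotp_mulmx_symmetric {S : 'M[R]_m} (S_sym : S^T = S) u v :
  dotp (u *m S) v = dotp (v *m S) u.
Proof.
have E x y : dotp x y = (x *m y^T) ord0 ord0.
  by rewrite mxE; apply: eq_bigr => j _; rewrite !mxE.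
rewrite (dotpC (v *m S)) !E trmx_mul S_sym mulmxA //.
Qed.

(** * The smallest eigenvalue as a lower bound of the quadratic form *)

Lemma continuous_dotp (f g : 'rV[R]_m -> 'rV[R]_m) :
  (forall j, continuous (fun v => f v ord0 j)) ->
  (forall j, continuous (fun v => g v ord0 j)) ->
  continuous (fun v => dotp (f v) (g v)).
Proof.
move=> f_cont g_cont; rewrite /dotp.
apply: continuous_big => [|j _ v]; first exact: add_continuous.
exact: (cvgM (f_cont j v) (g_cont j v)).
Qed.

Lemma continuous_mulmxr (S : 'M[R]_m) j :
  continuous (fun v : 'rV[R]_m => (v *m S) ord0 j).
Proof.
under eq_fun do rewrite mxE.
apply: continuous_big => [|k _ v]; first exact: add_continuous.
exact: (cvgM (@coord_continuous _ _ _ ord0 k v) (cvg_cst (S k j))).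
Qed.

Lemma compact_unit_sphere : compact [set u : 'rV[R]_m | dotp u u = 1]%classic.
Proof.
have sphere_closed : closed [set u : 'rV[R]_m | dotp u u = 1]%classic.
  apply: (@preimage_closed _ _ (fun u => dotp u u) [set x | x = 1]%classic).
    by move=> u _; apply: continuous_dotp => j {}u; exact: coord_continuous.
  exact: closed_eq.
apply: bounded_closed_compact sphere_closed.
exists 1; split=> // M M_gt1 v /= v1; apply: le_trans (ltW M_gt1).
(* Boundedness refers to the sup norm; the square of each entry is one summand of [dotp v v = 1]. *)
rewrite [leLHS]/Num.norm /= mx_normrE; apply/bigmax_leP; split=> // -[a i] _ /=.
rewrite (ord1 a) -(@ler_pXn2r _ 2) ?nnegrE // expr1n.
rewrite real_normK ?num_real // -v1 /dotp (bigD1 i) //= -expr2 lerDl.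
by apply: sumr_ge0 => j _; rewrite -expr2 sqr_ge0.
Qed.

(** The form attains its minimum over the unit sphere at some [u0], which is an eigenvector for the
    eigenvalue [f u0]; the infimum of the spectrum is at most that value. *)
Lemma lambda_min_le_quadratic_form (S : 'M[R]_m) (S_sym : S^T = S) v :
  lambda_min S * dotp v v <= dotp (v *m S) v.
Proof.
have [->|v_neq0] := eqVneq v 0; first by rewrite mul0mx !dotp0l mulr0.
pose f u : R := dotp (u *m S) u.
have f_cont : continuous f.
  apply: continuous_dotp => j; first exact: continuous_mulmxr.
  by move=> u; exact: coord_continuous.
have normalize u : u != 0 -> dotp ((l2norm u)^-1 *: u) ((l2norm u)^-1 *: u) = 1.
  move=> u_neq0; rewrite dotpZl dotpZr -sqr_l2norm mulrA -expr2 -exprMn.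
  by rewrite mulVf ?expr1n // -sqrf_eq0 sqr_l2norm dotp_eq0.
have [||u0] := @EVT_min_rV R m f [set u | dotp u u = 1]%classic _ compact_unit_sphere.
- by exists ((l2norm v)^-1 *: v); exact: normalize.
- exact: continuous_subspaceT.
rewrite inE /= => u0_unit u0_min.
(* Homogeneity of degree two carries minimality from the sphere to all vectors. *)
have f_ge u : f u0 * dotp u u <= f u.
  have [->|u_neq0] := eqVneq u 0; first by rewrite /f mul0mx !dotp0l mulr0.
  have nu_gt0 : 0 < l2norm u ^+ 2 by rewrite sqr_l2norm lt_def dotp_eq0 u_neq0 dotp_ge0.
  have := u0_min ((l2norm u)^-1 *: u); rewrite inE /= => /(_ (normalize _ u_neq0)).
  rewrite {2}/f -scalemxAl dotpZl dotpZr mulrA -expr2 -sqr_l2norm exprVn.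
  by rewrite mulrC -ler_pdivlMr // mulrC.
have u0_eigen : u0 *m S = f u0 *: u0.
  (* The form of [A] is nonnegative and vanishes at [u0], so its derivative
     there, in the direction [u0 *m A] in particular, vanishes as well. *)
  pose A := S - (f u0)%:M.
  have A_sym : A^T = A by rewrite /A linearB /= S_sym tr_scalar_mx.
  have qA u : dotp (u *m A) u = f u - f u0 * dotp u u.
    by rewrite /A mulmxBr mul_mx_scalar dotpBl dotpZl.
  have A_ge0 u : 0 <= dotp (u *m A) u by rewrite qA subr_ge0.
  have u0A : dotp (u0 *m A) u0 = 0 by rewrite qA u0_unit mulr1 subrr.
  suff : u0 *m A == 0 by rewrite /A mulmxBr mul_mx_scalar subr_eq0 => /eqP.
  set z := u0 *m A; rewrite -dotp_eq0 eq_le dotp_ge0 andbT.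
  rewrite leNgt; apply/negP => z_gt0.
  have expand (t : R) : 0 <= t ^+ 2 * dotp (z *m A) z - 2 * t * dotp z z.
    have := A_ge0 (u0 - t *: z).
    rewrite mulmxBl -scalemxAl !(dotpBl, dotpBr) !(dotpZl, dotpZr) u0A.
    by rewrite (dotp_mulmx_symmetric A_sym z u0) -/z; lra.
  set c := dotp (z *m A) z in expand.
  have c_ge0 : 0 <= c by exact: A_ge0.
  (* A step short enough for the linear term to win; the denominator [1 + c] instead of [c] covers
     [c = 0]. *)
  pose t : R := dotp z z / (1 + c).
  have zzE : dotp z z = t * (1 + c) by rewrite /t divfK // gt_eqF // ltr_wpDr.
  have t_gt0 : 0 < t by rewrite divr_gt0 // ltr_wpDr.
  have := expand t; rewrite zzE; apply/negP; rewrite -ltNge.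
  have -> : t ^+ 2 * c - 2 * t * (t * (1 + c)) = - (t ^+ 2 * (2 + c)) by ring.
  by rewrite oppr_lt0 mulr_gt0 ?exprn_gt0 // ltr_wpDr.
apply: le_trans (f_ge v); rewrite ler_wpM2r ?dotp_ge0 //.
apply: ge_inf; last first.
  by apply/eigenvalueP; exists u0; rewrite // -dotp_eq0 u0_unit oner_eq0.
(* The infimum is only meaningful for a spectrum bounded below, and [f u0] is such a bound. *)
exists (f u0) => l /= /eigenvalueP[u uS u_neq0].
have u_gt0 : 0 < dotp u u by rewrite lt_def dotp_eq0 u_neq0 dotp_ge0.
by have := f_ge u; rewrite /f uS dotpZl ler_pM2r.
Qed.
End Dot.

(** * Gibbs weights *)

Lemma is_derive_affine (R : realType) (t a b : R) :
  is_derive t 1 (fun s : R => a + s * b) b.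
Proof.
have := is_deriveD (is_derive_cst a t 1)
  (is_deriveM (is_derive_id t 1) (is_derive_cst b t 1)).
by move/is_derive_eq; apply; rewrite /GRing.scale /=; ring.
Qed.

(** The difference quotients from the right are nonpositive. The one-sided form is needed because a
    constrained maximizer may lie on the boundary of the ball. *)
Lemma is_derive_le0_at_max (R : realType) (f : R -> R) (d : R) :
  is_derive (0 : R) 1 f d -> (forall s, 0 < s <= 1 -> f s <= f 0) -> d <= 0.
Proof.
move=> [f_deriv <-] f_max.
have /cvg_dnbhs_at_right fcvg := f_deriv.
apply: (cvgr_to_le fcvg).
near=> h.
have h_gt0 : 0 < h by near: h; exact: nbhs_right_gt.
rewrite /= /GRing.scale /= mulr1 addr0 pmulr_rle0 ?invr_gt0 // subr_le0.
apply: f_max; rewrite h_gt0 /=; near: h; exact: nbhs_right_le.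
Unshelve. all: by end_near.
Qed.

Section Gibbs.
Variables (R : realType) (n : nat) (q : 'I_n -> R).
Hypotheses (n_gt0 : (0 < n)%N) (q_gt0 : forall i, 0 < q i).
Implicit Types x y f : 'I_n -> R.

Definition partition_fun x : R := \sum_i q i * expR (x i).

Definition gibbs x i : R := q i * expR (x i) / partition_fun x.

Definition gibbs_mean x f : R := \sum_i gibbs x i * f i.

Definition gibbs_cov x f g : R :=
  gibbs_mean x (fun i => f i * g i) - gibbs_mean x f * gibbs_mean x g.

Lemma partition_fun_gt0 x : 0 < partition_fun x.
Proof.
rewrite /partition_fun (bigD1 (Ordinal n_gt0)) //= ltr_pwDl //.
  by rewrite mulr_gt0 ?expR_gt0.
by apply: sumr_ge0 => i _; rewrite mulr_ge0 ?expR_ge0 // ltW.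
Qed.

Lemma gibbs_gt0 x i : 0 < gibbs x i.
Proof. by rewrite divr_gt0 ?mulr_gt0 ?expR_gt0 ?partition_fun_gt0. Qed.

Lemma gibbs_ge0 x i : 0 <= gibbs x i.
Proof. exact/ltW/gibbs_gt0. Qed.

Lemma sum_gibbs x : \sum_i gibbs x i = 1.
Proof. by rewrite -mulr_suml divff // gt_eqF // partition_fun_gt0. Qed.

Lemma gibbs_meanE x f :
  gibbs_mean x f = (\sum_i q i * expR (x i) * f i) / partition_fun x.
Proof. by rewrite mulr_suml; apply: eq_bigr => i _; rewrite mulrAC. Qed.

(** Bias-variance decomposition. Taking [c] to be the mean writes the variance as a sum of squares;
    taking [c = 0] bounds it by the second moment. *)
Lemma gibbs_cov_sqr x f c :
  gibbs_mean x (fun i => (f i - c) ^+ 2) =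
    gibbs_cov x f f + (gibbs_mean x f - c) ^+ 2.
Proof.
transitivity (gibbs_mean x (fun i => f i * f i) - 2 * c * gibbs_mean x f
    + c ^+ 2 * \sum_i gibbs x i); last by rewrite sum_gibbs /gibbs_cov; ring.
rewrite /gibbs_mean !mulr_sumr -sumrB -big_split.
by apply: eq_bigr => i _ /=; ring.
Qed.

Lemma gibbs_cov_le_mean x f : gibbs_cov x f f <= gibbs_mean x (fun i => f i ^+ 2).
Proof.
have := gibbs_cov_sqr x f 0; rewrite /gibbs_mean.
under eq_bigr do rewrite subr0.
by move=> ->; rewrite lerDl sqr_ge0.
Qed.

Lemma gibbs_cov_ge0 x f : 0 <= gibbs_cov x f f.
Proof.
have := gibbs_cov_sqr x f (gibbs_mean x f); rewrite subrr expr0n addr0 => <-.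
by apply: sumr_ge0 => i _; rewrite mulr_ge0 ?sqr_ge0 ?gibbs_ge0.
Qed.

(** Cauchy-Schwarz for the centred functions; each variance is then relaxed to a second moment,
    which is easier to bound. *)
Lemma gibbs_cov_cauchy_schwarz x f g :
  gibbs_cov x f g ^+ 2 <=
    gibbs_mean x (fun i => f i ^+ 2) * gibbs_mean x (fun i => g i ^+ 2).
Proof.
pose F i := f i - gibbs_mean x f; pose G i := g i - gibbs_mean x g.
have cov_FG : gibbs_cov x f g = \sum_i gibbs x i * (F i * G i).
  have -> : \sum_i gibbs x i * (F i * G i) = \sum_i (gibbs x i * (f i * g i)
      + - gibbs_mean x g * (gibbs x i * f i) + - gibbs_mean x f * (gibbs x i * g i)
      + gibbs_mean x f * gibbs_mean x g * gibbs x i).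
    by apply: eq_bigr => i _; rewrite /F /G; ring.
  rewrite !big_split -!mulr_sumr sum_gibbs /= /gibbs_cov.
  rewrite -/(gibbs_mean x f) -/(gibbs_mean x g).
  by rewrite -/(gibbs_mean x (fun i => f i * g i)); ring.
have sqr_cov h : \sum_i gibbs x i * (h i - gibbs_mean x h) ^+ 2 = gibbs_cov x h h.
  by have := gibbs_cov_sqr x h (gibbs_mean x h); rewrite subrr expr0n addr0.
rewrite cov_FG (le_trans (weighted_cauchy_schwarz _ _ (gibbs_ge0 x))) //.
by rewrite !sqr_cov ler_pM ?gibbs_cov_ge0 ?gibbs_cov_le_mean.
Qed.

Lemma is_derive_exp_sum x y (f f' : 'I_n -> R) (t : R) :
  is_derive t 1 (fun s : R => \sum_i q i * expR (x i + s * y i) * (f i + s * f' i))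
    (\sum_i q i * expR (x i + t * y i) * (f' i + (f i + t * f' i) * y i)).
Proof.
have term i : is_derive t 1
    (fun s : R => q i * expR (x i + s * y i) * (f i + s * f' i))
    (q i * expR (x i + t * y i) * (f' i + (f i + t * f' i) * y i)).
  have := is_deriveM (is_deriveM (is_derive_cst (q i) t 1)
    (is_derive1_comp (is_derive_expR _) (is_derive_affine _ (x i) (y i))))
    (is_derive_affine _ (f i) (f' i)).
  by move/is_derive_eq; apply; rewrite !fctE /GRing.scale /=; ring.
have := is_derive_sum term.
by congr (is_derive _ _ _ _); apply/funext => s; rewrite fct_sumE.
Qed.

Lemma is_derive_partition_fun x y (t : R) :
  is_derive t 1 (fun s : R => partition_fun (fun i => x i + s * y i))
    (\sum_i q i * expR (x i + t * y i) * y i).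
Proof.
have := is_derive_exp_sum x y (fun=> 1) (fun=> 0) t.
under eq_fun do under eq_bigr do rewrite mulr0 addr0 mulr1.
by under eq_bigr do rewrite mulr0 addr0 add0r mul1r.
Qed.

(** By the quotient rule, the motion of the test function contributes a mean and that of the
    exponents a covariance. Both move when the rows of the data change. *)
Lemma is_derive_gibbs_mean x y (f f' : 'I_n -> R) (t : R) :
  is_derive t 1
    (fun s : R => gibbs_mean (fun i => x i + s * y i) (fun i => f i + s * f' i))
    (gibbs_mean (fun i => x i + t * y i) f' +
     gibbs_cov (fun i => x i + t * y i) (fun i => f i + t * f' i) y).
Proof.
under eq_fun do rewrite gibbs_meanE.
set xt := fun i => x i + t * y i.
have Z_neq0 : partition_fun xt != 0 by rewrite gt_eqF // partition_fun_gt0.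
have := is_deriveM (is_derive_exp_sum x y f f' t)
  (is_deriveV Z_neq0 (is_derive_partition_fun x y t)).
move/is_derive_eq; apply; rewrite /GRing.scale /= /gibbs_cov !gibbs_meanE -/xt.
have -> : \sum_i q i * expR (x i + t * y i) * (f' i + (f i + t * f' i) * y i) =
    \sum_i q i * expR (xt i) * f' i
    + \sum_i q i * expR (xt i) * ((f i + t * f' i) * y i).
  by rewrite -big_split; apply: eq_bigr => i _; rewrite mulrDr.
rewrite -/xt /=.
by field.
Qed.
End Gibbs.

(** * Mean value estimates for Gibbs weights *)

Section GibbsBounds.
Variables (R : realType) (n : nat) (q : 'I_n -> R).
Hypotheses (n_gt0 : (0 < n)%N) (q_gt0 : forall i, 0 < q i).
Implicit Types x y f : 'I_n -> R.

Lemma gibbs_mean_increment x y f f' :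
  exists2 t : R, 0 <= t <= 1 &
    gibbs_mean q (fun i => x i + y i) (fun i => f i + f' i) - gibbs_mean q x f =
      gibbs_mean q (fun i => x i + t * y i) f' +
      gibbs_cov q (fun i => x i + t * y i) (fun i => f i + t * f' i) y.
Proof.
pose F s := gibbs_mean q (fun i => x i + s * y i) (fun i => f i + s * f' i).
have F_deriv (s : R) := is_derive_gibbs_mean n_gt0 q_gt0 x y f f' s.
have [|t] := @MVT R F _ 0 1 ltr01 (fun s _ => F_deriv s).
  apply: derivable_within_continuous => s _.
  by have [] := F_deriv s.
rewrite in_itv /= subr0 mulr1 => /andP[t_gt0 t_lt1] FE.
exists t; first by rewrite !ltW.
rewrite -FE; congr (_ - _); rewrite /F; congr gibbs_mean;
  by apply/funext => i; rewrite ?mul1r ?mul0r ?addr0.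
Qed.

Lemma gibbs_mean_increment_cst x y f :
  exists2 t : R, 0 <= t <= 1 &
    gibbs_mean q (fun i => x i + y i) f - gibbs_mean q x f =
      gibbs_cov q (fun i => x i + t * y i) f y.
Proof.
have [t t01] := gibbs_mean_increment x y f (fun=> 0).
have -> : (fun i => f i + 0) = f by apply/funext => i; rewrite addr0.
have -> : (fun i => f i + t * 0) = f by apply/funext => i; rewrite mulr0 addr0.
rewrite [X in _ = X + _]big1 => [|i _]; last by rewrite mulr0.
by rewrite add0r; exists t.
Qed.

Lemma is_derive_ln_partition_fun x y :
  is_derive (0 : R) 1 (fun s : R => ln (partition_fun q (fun i => x i + s * y i)))
    (gibbs_mean q x y).
Proof.
have x0 : (fun i => x i + 0 * y i) = x by apply/funext => i; rewrite mul0r addr0.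
have Z_gt0 := partition_fun_gt0 n_gt0 q_gt0 (fun i => x i + 0 * y i).
have := is_derive1_comp (is_derive1_ln Z_gt0) (is_derive_partition_fun q x y 0).
move/is_derive_eq; apply; rewrite gibbs_meanE x0 mulrC.
by congr (_ / _); apply: eq_bigr => i _; rewrite mul0r addr0.
Qed.

Section Comparable.
Variables (M : R) (x : 'I_n -> R).
Hypothesis comparable : forall i j, q i * expR (x i) <= M * (q j * expR (x j)).

(** Summing [comparable] over [j] bounds [n] copies of one unnormalized weight by [M] times the
    partition function. *)
Lemma gibbs_le i : gibbs q x i <= M / n%:R.
Proof.
have n_gt0' : 0 < n%:R :> R by rewrite ltr0n.
rewrite ler_pdivrMr ?partition_fun_gt0 // mulrAC ler_pdivlMr //.
rewrite mulr_sumr mulr_natr -[X in _ *+ X]card_ord -sumr_const.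
exact: ler_sum.
Qed.

Lemma gibbs_ge i : M^-1 / n%:R <= gibbs q x i.
Proof.
have n_gt0' : 0 < n%:R :> R by rewrite ltr0n.
have w_gt0 j : 0 < q j * expR (x j) by rewrite mulr_gt0 ?expR_gt0.
have M_gt0 : 0 < M by have := lt_le_trans (w_gt0 i) (comparable i i); rewrite pmulr_lgt0.
rewrite ler_pdivlMr ?partition_fun_gt0 // mulrAC ler_pdivrMr // ler_pdivrMl //.
rewrite mulrA mulr_natr -[X in _ *+ X]card_ord -sumr_const.
exact: ler_sum.
Qed.

(** The empirical mean minimizes the unweighted sum of squared deviations, so centring at the Gibbs
    mean can only increase it; each Gibbs weight is then at least [M^-1 / n]. *)
Lemma gibbs_cov_ge f :
  M^-1 * (n%:R^-1 * \sum_i (f i - n%:R^-1 * \sum_j f j) ^+ 2) <= gibbs_cov q x f f.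
Proof.
have n_neq0 : n%:R != 0 :> R by rewrite pnatr_eq0 -lt0n.
set m := n%:R^-1 * \sum_j f j; set c := gibbs_mean q x f.
have -> : gibbs_cov q x f f = \sum_i gibbs q x i * (f i - c) ^+ 2.
  by have := gibbs_cov_sqr n_gt0 q_gt0 x f c; rewrite subrr expr0n addr0.
have sum_f : \sum_j f j = n%:R * m by rewrite /m mulrA divff // mul1r.
have le_sum : \sum_i (f i - m) ^+ 2 <= \sum_i (f i - c) ^+ 2.
  have -> : \sum_i (f i - c) ^+ 2 =
      \sum_i ((f i - m) ^+ 2 + (2 * (m - c) * f i + (c ^+ 2 - m ^+ 2))).
    by apply: eq_bigr => i _; ring.
  rewrite big_split lerDl big_split -mulr_sumr sum_f sumr_const card_ord /=.
  have -> : 2 * (m - c) * (n%:R * m) + (c ^+ 2 - m ^+ 2) *+ n = n%:R * (m - c) ^+ 2.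
    by rewrite -mulr_natr; ring.
  by rewrite mulr_ge0 ?sqr_ge0.
rewrite mulrA; apply: le_trans (_ : M^-1 / n%:R * \sum_i (f i - c) ^+ 2 <= _).
  have := gibbs_ge (Ordinal n_gt0).
  rewrite ler_wpM2l // divr_ge0 // invr_ge0.
  have w_gt0 j : 0 < q j * expR (x j) by rewrite mulr_gt0 ?expR_gt0.
  pose i := Ordinal n_gt0.
  by apply/ltW; have := lt_le_trans (w_gt0 i) (comparable i i); rewrite pmulr_lgt0.
by rewrite mulr_sumr ler_sum // => i _; rewrite ler_wpM2r ?sqr_ge0 ?gibbs_ge.
Qed.
End Comparable.

(** The mean value formula is tested with the increment [u] of the weights itself: [\sum_i u i ^+ 2]
    becomes a covariance of [u] and [y], whose square is at most [M * V] times that same sum, and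
    one factor cancels. *)
Lemma gibbs_lipschitz x y (M V : R) :
  (forall t i, 0 <= t <= 1 -> gibbs q (fun i => x i + t * y i) i <= M) ->
  (forall t, 0 <= t <= 1 ->
     gibbs_mean q (fun i => x i + t * y i) (fun i => y i ^+ 2) <= V) ->
  \sum_i (gibbs q (fun i => x i + y i) i - gibbs q x i) ^+ 2 <= M * V.
Proof.
move=> gibbs_leM mean_leV.
pose u i := gibbs q (fun i => x i + y i) i - gibbs q x i.
have [t t01 cov_u] := gibbs_mean_increment_cst x y u.
set xt := fun i => x i + t * y i in cov_u.
have sum_u : \sum_i u i ^+ 2 = gibbs_cov q xt u y.
  by rewrite -cov_u /gibbs_mean -sumrB; apply: eq_bigr => i _; rewrite /u; ring.
have u_ge0 : 0 <= \sum_i u i ^+ 2 by apply: sumr_ge0 => i _; exact: sqr_ge0.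
have mean_ge0 f : 0 <= gibbs_mean q xt (fun i => f i ^+ 2).
  by apply: sumr_ge0 => i _; rewrite mulr_ge0 ?sqr_ge0 ?gibbs_ge0.
have mean_u : gibbs_mean q xt (fun i => u i ^+ 2) <= M * \sum_i u i ^+ 2.
  by rewrite mulr_sumr ler_sum // => i _; rewrite ler_wpM2r ?sqr_ge0 ?gibbs_leM.
have := gibbs_cov_cauchy_schwarz n_gt0 q_gt0 xt u y.
rewrite -sum_u => /le_trans/(_ (ler_pM (mean_ge0 u) (mean_ge0 y) mean_u (mean_leV _ t01))).
change (\sum_i _) with (\sum_i u i ^+ 2).
have [->|u_neq0] := eqVneq (\sum_i u i ^+ 2) 0.
  move=> _; rewrite mulr_ge0 //.
    by apply: le_trans (gibbs_leM t (Ordinal n_gt0) t01); exact: gibbs_ge0.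
  exact: le_trans (mean_ge0 y) (mean_leV t t01).
by rewrite expr2 mulrAC ler_pM2r // lt_def u_neq0.
Qed.
End GibbsBounds.

(** * Stability of the regularized dual *)

Section RegularizedDual.
Variables (R : realType) (n m : nat) (q : 'I_n -> R) (rq RE lamE lmin : R).
Hypotheses (n_gt0 : (0 < n)%N) (q_gt0 : forall i, 0 < q i).
Hypothesis q_comparable : forall i j, q i <= rq * q j.
Implicit Types (b : 'I_n -> 'rV[R]_m) (h u v lam mu : 'rV[R]_m).

Definition dual_objective b h lam : R :=
  dotp lam h - ln (partition_fun q (fun i => dotp lam (b i)))
  - lamE / 2 * l2norm lam ^+ 2.

Definition dual_argmax b h lam : Prop :=
  l2norm lam <= RE /\
  forall mu, l2norm mu <= RE -> dual_objective b h mu <= dual_objective b h lam.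

Definition dual_mean b lam v : R :=
  gibbs_mean q (fun i => dotp lam (b i)) (fun i => dotp v (b i)).

Lemma dual_meanN b lam v : dual_mean b lam (- v) = - dual_mean b lam v.
Proof.
by rewrite /dual_mean /gibbs_mean -sumrN; apply: eq_bigr => i _; rewrite dotpNl mulrN.
Qed.

Lemma ratio_ge1 : 1 <= rq.
Proof.
have := q_comparable (Ordinal n_gt0) (Ordinal n_gt0).
by rewrite ler_pMl.
Qed.

(** Two exponents in [[-S, S]] differ by at most [2 * S]. *)
Lemma tilted_comparable (S : R) (x : 'I_n -> R) :
  (forall i, `|x i| <= S) ->
  forall i j, q i * expR (x i) <= rq * expR (2 * S) * (q j * expR (x j)).
Proof.
move=> x_le i j.
have -> : rq * expR (2 * S) * (q j * expR (x j)) = rq * q j * expR (2 * S + x j).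
  by rewrite expRD; ring.
rewrite ler_pM ?expR_ge0 ?q_comparable ?(ltW (q_gt0 i)) // ler_expR.
by have := x_le i; have := x_le j; rewrite !ler_norml => /andP[? ?] /andP[? ?]; lra.
Qed.

Lemma gibbs_le_ball (S : R) (x : 'I_n -> R) i :
  (forall i, `|x i| <= S) -> gibbs q x i <= rq * expR (2 * S) / n%:R.
Proof. by move=> x_le; apply: gibbs_le => //; exact: tilted_comparable. Qed.

Lemma dotp_ball (S : R) lam v : l2norm lam <= S -> l2norm v <= 1 -> `|dotp lam v| <= S.
Proof.
move=> lamS v1; apply: le_trans (normr_dotp_le _ _) _.
have S_ge0 := le_trans (l2norm_ge0 lam) lamS.
by rewrite -[leRHS]mulr1 ler_pM ?l2norm_ge0.
Qed.

Lemma l2norm_segment (S : R) u v (t : R) : 0 <= t <= 1 ->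
  l2norm u <= S -> l2norm v <= S -> l2norm (u + t *: (v - u)) <= S.
Proof.
case/andP=> t_ge0 t_le1 uS vS.
have -> : u + t *: (v - u) = (1 - t) *: u + t *: v.
  by rewrite scalerBr scalerBl scale1r addrA addrAC.
apply: le_trans (l2normD _ _) _; rewrite !l2normZ !ger0_norm ?subr_ge0 //.
have -> : S = (1 - t) * S + t * S by ring.
by rewrite lerD // ler_wpM2l ?subr_ge0.
Qed.

Lemma dotp_line lam v u (t : R) : dotp (lam + t *: v) u = dotp lam u + t * dotp v u.
Proof. by rewrite dotpDl dotpZl. Qed.

(** Variational inequality of a constrained maximum: by convexity the segment from [lam] to [mu]
    stays in the ball, so the derivative of the objective along it is nonpositive at [lam]. *)
Lemma dual_first_order b h lam mu :
  dual_argmax b h lam -> l2norm mu <= RE ->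
  dotp (mu - lam) h - dual_mean b lam (mu - lam) - lamE * dotp lam (mu - lam) <= 0.
Proof.
move=> [lamRE lam_max] muRE.
set v := mu - lam.
have ball (s : R) : 0 <= s <= 1 -> l2norm (lam + s *: v) <= RE.
  by move=> s01; exact: l2norm_segment.
(* From here on [mu] matters only through the direction [v]. *)
clearbody v => {mu muRE}.
pose f (s : R) := dotp lam h + s * dotp v h
  - ln (partition_fun q (fun i => dotp lam (b i) + s * dotp v (b i)))
  - lamE / 2 * (dotp lam lam + s * (2 * dotp lam v + s * dotp v v)).
have fE s : f s = dual_objective b h (lam + s *: v).
  rewrite /dual_objective sqr_l2norm dotpDl dotpZl /f.
  under [in RHS]eq_fun do rewrite dotp_line.
  by rewrite !(dotpDl, dotpDr) !(dotpZl, dotpZr) (dotpC v lam); ring.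
apply: (is_derive_le0_at_max (f := f)); last first.
  move=> s /andP[s_gt0 s_le1]; rewrite !fE scale0r addr0.
  by apply/lam_max/ball; rewrite ltW.
have quad (a c d : R) : is_derive (0 : R) 1 (fun s : R => a + s * (c + s * d)) c.
  have := is_deriveD (is_derive_cst a (0 : R) 1)
    (is_deriveM (is_derive_id (0 : R) 1) (is_derive_affine _ c d)).
  by move/is_derive_eq; apply; rewrite /GRing.scale /=; ring.
have := is_deriveB (is_deriveB (is_derive_affine _ (dotp lam h) (dotp v h))
    (is_derive_ln_partition_fun n_gt0 q_gt0 (fun i => dotp lam (b i))
       (fun i => dotp v (b i))))
  (is_deriveM (is_derive_cst (lamE / 2) (0 : R) 1)
    (quad (dotp lam lam) (2 * dotp lam v) (dotp v v))).
move/is_derive_eq; apply; rewrite !fctE /GRing.scale /= /dual_mean.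
by field.
Qed.

(** The increment of the Gibbs mean of [dotp v (b i)] is its Gibbs variance at a point of the
    segment, hence in the ball, where it dominates the empirical variance. *)
Lemma dual_strong_monotone b lam mu :
  (forall i, l2norm (b i) <= 1) ->
  (forall v, lmin * dotp v v <=
     n%:R^-1 * \sum_i (dotp v (b i) - n%:R^-1 * \sum_j dotp v (b j)) ^+ 2) ->
  l2norm lam <= RE -> l2norm mu <= RE ->
  (rq^-1 * expR (- 2 * RE) * lmin + lamE) * l2norm (mu - lam) ^+ 2 <=
    dual_mean b mu (mu - lam) - dual_mean b lam (mu - lam)
    + lamE * l2norm (mu - lam) ^+ 2.
Proof.
move=> b_le1 cov_ge lamRE muRE; set v := mu - lam.
rewrite mulrDl lerD2r sqr_l2norm.
have [t t01] := gibbs_mean_increment_cst n_gt0 q_gt0 (fun i => dotp lam (b i))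
  (fun i => dotp v (b i)) (fun i => dotp v (b i)).
have -> : (fun i => dotp lam (b i) + dotp v (b i)) = (fun i => dotp mu (b i)).
  by apply/funext => i; rewrite -dotpDl addrC subrK.
rewrite /dual_mean => ->.
have -> : (fun i => dotp lam (b i) + t * dotp v (b i)) =
    (fun i => dotp (lam + t *: v) (b i)) by apply/funext => i; rewrite dotp_line.
set xt := fun i => dotp (lam + _) _.
have xt_le i : `|xt i| <= RE by apply: dotp_ball => //; exact: l2norm_segment.
have := gibbs_cov_ge n_gt0 q_gt0 (tilted_comparable xt_le) (fun i => dotp v (b i)).
apply: le_trans.
rewrite invfM -expRN -mulNr -mulrA ler_wpM2l ?cov_ge //.
by rewrite mulr_ge0 ?expR_ge0 // invr_ge0 (le_trans ler01) // ratio_ge1.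
Qed.

(** Strong monotonicity between [0] and [lam] meets optimality of [lam] against [0]; what remains is
    the gradient at [0], of norm at most [1 + l2norm h]. *)
Lemma dual_norm_le b h lam :
  (forall i, l2norm (b i) <= 1) ->
  (forall v, lmin * dotp v v <=
     n%:R^-1 * \sum_i (dotp v (b i) - n%:R^-1 * \sum_j dotp v (b j)) ^+ 2) ->
  dual_argmax b h lam ->
  (rq^-1 * expR (- 2 * RE) * lmin + lamE) * l2norm lam <= 1 + l2norm h.
Proof.
move=> b_le1 cov_ge lam_max; have [lamRE _] := lam_max.
have RE_ge0 := le_trans (l2norm_ge0 lam) lamRE.
have zeroRE : l2norm (0 : 'rV[R]_m) <= RE by rewrite l2norm0.
have := dual_first_order lam_max zeroRE.
have := dual_strong_monotone b_le1 cov_ge zeroRE lamRE.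
set rho := _ + lamE; rewrite subr0 sub0r.
rewrite dual_meanN dotpNl dotpNr sqr_l2norm => strong opt.
have mean0 : - dual_mean b 0 lam <= l2norm lam.
  rewrite /dual_mean /gibbs_mean -sumrN -[leRHS]mul1r.
  set x := fun i => dotp 0 (b i).
  rewrite -(sum_gibbs n_gt0 q_gt0 x) mulr_suml ler_sum // => i _.
  rewrite -mulrN ler_wpM2l ?gibbs_ge0 //.
  have /(dotp_ball (lexx _)) := b_le1 i; move=> /(_ lam).
  by rewrite ler_norml => /andP[]; lra.
have := dotp_le lam h; rewrite -sqr_l2norm in strong opt *.
have [-> _|lam_neq0 lamh] := eqVneq (l2norm lam) 0.
  by rewrite mulr0 addr_ge0 ?l2norm_ge0.
have lam_gt0 : 0 < l2norm lam by rewrite lt_def lam_neq0 l2norm_ge0.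
rewrite -(ler_pM2r lam_gt0) -mulrA -expr2.
by move: strong opt lamh mean0; lra.
Qed.

(** Each maximizer is tested against the other, and the two inequalities are added to strong
    monotonicity. The latter is available for [b] alone, which is why the gradients are compared at
    [lam']. *)
Lemma dual_stability b b' h h' lam lam' :
  (forall i, l2norm (b i) <= 1) ->
  (forall v, lmin * dotp v v <=
     n%:R^-1 * \sum_i (dotp v (b i) - n%:R^-1 * \sum_j dotp v (b j)) ^+ 2) ->
  dual_argmax b h lam -> dual_argmax b' h' lam' ->
  (rq^-1 * expR (- 2 * RE) * lmin + lamE) * l2norm (lam' - lam) ^+ 2 <=
    dual_mean b lam' (lam' - lam) - dual_mean b' lam' (lam' - lam)
    - dotp (lam' - lam) (h - h').
Proof.
move=> b_le1 cov_ge lam_max lam'_max.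
have [lamRE _] := lam_max; have [lam'RE _] := lam'_max.
have := dual_first_order lam_max lam'RE; have := dual_first_order lam'_max lamRE.
have := dual_strong_monotone b_le1 cov_ge lamRE lam'RE.
set rho := _ + lamE; rewrite -(opprB lam' lam); set v := lam' - lam.
have vv : l2norm v ^+ 2 = dotp lam' v - dotp lam v by rewrite sqr_l2norm {1}/v dotpBl.
rewrite dual_meanN dotpNl dotpNr dotpBr.
have -> : lamE * l2norm v ^+ 2 = lamE * dotp lam' v - lamE * dotp lam v.
  by rewrite vv mulrBr.
by lra.
Qed.

(** The rows move along the segments from [b' i] to [b i]. The test function contributes the first
    term, through the bound on a single Gibbs weight; the exponents contribute the second. *)
Lemma dual_mean_perturbation b b' lam v (M := rq * expR (2 * RE)) :
  (forall i, l2norm (b i) <= 1) -> (forall i, l2norm (b' i) <= 1) ->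
  l2norm lam <= RE -> \sum_i l2norm (b i - b' i) ^+ 2 <= 4 ->
  dual_mean b lam v - dual_mean b' lam v <=
    l2norm v * (M / n%:R * \sum_i l2norm (b i - b' i) + 2 * RE * Num.sqrt (M / n%:R)).
Proof.
move=> b_le1 b'_le1 lamRE diff_le4.
have RE_ge0 := le_trans (l2norm_ge0 lam) lamRE.
have M_ge0 : 0 <= M / n%:R.
  by rewrite divr_ge0 ?mulr_ge0 ?expR_ge0 // (le_trans ler01 ratio_ge1).
have [t t01] := gibbs_mean_increment n_gt0 q_gt0 (fun i => dotp lam (b' i))
  (fun i => dotp lam (b i - b' i)) (fun i => dotp v (b' i)) (fun i => dotp v (b i - b' i)).
have sumE u : (fun i => dotp u (b' i) + dotp u (b i - b' i)) = (fun i => dotp u (b i)).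
  by apply/funext => i; rewrite -dotpDr addrC subrK.
rewrite !sumE /dual_mean => ->.
pose bt i := b' i + t *: (b i - b' i).
have lineE u : (fun i => dotp u (b' i) + t * dotp u (b i - b' i)) =
    (fun i => dotp u (bt i)).
  by apply/funext => i; rewrite [RHS]dotpDr dotpZr.
rewrite !lineE; set xt := fun i => dotp lam (bt i).
have bt_le1 i : l2norm (bt i) <= 1 by exact: l2norm_segment.
have xt_le i : `|xt i| <= RE by exact: dotp_ball.
have gibbs_leM i : gibbs q xt i <= M / n%:R by exact: gibbs_le_ball.
rewrite mulrDr lerD //.
  rewrite mulrA mulr_sumr ler_sum // => i _.
  apply: le_trans (_ : gibbs q xt i * (l2norm v * l2norm (b i - b' i)) <= _).
    by rewrite ler_wpM2l ?gibbs_ge0 // dotp_le.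
  by rewrite mulrCA -[leRHS]mulrA !(ler_wpM2l, ler_wpM2r) ?l2norm_ge0.
(* The covariance term: one second moment is at most [l2norm v ^+ 2], the other at most [M / n]
   times [4 * RE ^+ 2]. *)
apply: le_trans (ler_norm _) _.
rewrite -(@ler_pXn2r _ 2) ?nnegrE ?mulr_ge0 ?l2norm_ge0 ?sqrtr_ge0 //.
rewrite real_normK ?num_real //.
apply: le_trans (gibbs_cov_cauchy_schwarz n_gt0 q_gt0 _ _ _) _.
rewrite !exprMn (sqr_sqrtr M_ge0).
have mean_ge0 f : 0 <= gibbs_mean q xt (fun i => f i ^+ 2).
  by apply: sumr_ge0 => i _; rewrite mulr_ge0 ?sqr_ge0 ?gibbs_ge0.
apply: ler_pM => //.
  rewrite -[leRHS]mul1r -(sum_gibbs n_gt0 q_gt0 xt) mulr_suml ler_sum // => i _.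
  rewrite ler_wpM2l ?gibbs_ge0 // -real_normK ?num_real //.
  by rewrite ler_pXn2r ?nnegrE ?l2norm_ge0 // dotp_ball.
apply: le_trans (_ : M / n%:R * (RE ^+ 2 * \sum_i l2norm (b i - b' i) ^+ 2) <= _).
  rewrite mulr_sumr mulr_sumr ler_sum // => i _.
  rewrite ler_pM ?sqr_ge0 ?gibbs_ge0 //.
  rewrite -real_normK ?num_real // -exprMn ler_pXn2r ?nnegrE ?mulr_ge0 ?l2norm_ge0 //.
  by rewrite (le_trans (normr_dotp_le _ _)) // ler_wpM2r ?l2norm_ge0.
rewrite [leRHS]mulrC ler_wpM2l // [leRHS]mulrC ler_wpM2l ?sqr_ge0 //.
by rewrite (le_trans diff_le4) // expr2; lra.
Qed.

(** In [gibbs_lipschitz] the weight bound enters twice, once for the weights and once in the second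
    moment of [dotp lam (b i - b' i)]. The radius [S] is free so that the smaller [deltaE] can be
    used. *)
Lemma gibbs_change_features b b' lam (S : R) :
  (forall i, l2norm (b i) <= 1) -> (forall i, l2norm (b' i) <= 1) ->
  l2norm lam <= S -> \sum_i l2norm (b i - b' i) ^+ 2 <= 4 ->
  \sum_i (gibbs q (fun i => dotp lam (b i)) i
          - gibbs q (fun i => dotp lam (b' i)) i) ^+ 2 <=
    (2 * S * (rq * expR (2 * S)) / n%:R) ^+ 2.
Proof.
move=> b_le1 b'_le1 lamS diff_le4.
have S_ge0 := le_trans (l2norm_ge0 lam) lamS.
set M := rq * expR (2 * S) / n%:R.
have M_ge0 : 0 <= M.
  by rewrite divr_ge0 ?mulr_ge0 ?expR_ge0 // (le_trans ler01 ratio_ge1).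
have bt_le1 (t : R) i : 0 <= t <= 1 -> l2norm (b' i + t *: (b i - b' i)) <= 1.
  by move=> t01; exact: l2norm_segment.
have gibbs_leM (t : R) i : 0 <= t <= 1 ->
    gibbs q (fun i => dotp lam (b' i) + t * dotp lam (b i - b' i)) i <= M.
  move=> t01; apply: gibbs_le_ball => {}i.
  by rewrite -dotpZr -dotpDr dotp_ball // bt_le1.
have diffE : (fun i => dotp lam (b i)) =
    (fun i => dotp lam (b' i) + dotp lam (b i - b' i)).
  by apply/funext => i; rewrite -dotpDr addrC subrK.
rewrite diffE.
apply: le_trans (gibbs_lipschitz (V := M * (4 * S ^+ 2)) n_gt0 q_gt0 gibbs_leM _) _.
  move=> t t01; apply: le_trans (_ : M * (S ^+ 2 * \sum_i l2norm (b i - b' i) ^+ 2) <= _).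
    rewrite mulr_sumr mulr_sumr ler_sum // => i _.
    rewrite ler_pM ?sqr_ge0 ?gibbs_ge0 ?gibbs_leM //.
    rewrite -real_normK ?num_real // -exprMn ler_pXn2r ?nnegrE ?mulr_ge0 ?l2norm_ge0 //.
    by rewrite (le_trans (normr_dotp_le _ _)) // ler_wpM2r ?l2norm_ge0.
  by rewrite ler_wpM2l // mulrC ler_wpM2r ?sqr_ge0.
rewrite -(mulrA (2 * S)) -/M (_ : M * _ = (2 * S * M) ^+ 2) //.
by ring.
Qed.

(** Here the exponents change by [dotp (lam' - lam) (b i)], each bounded by the norm of
    [lam' - lam], so the weight bound enters only once. *)
Lemma gibbs_change_parameter b lam lam' :
  (forall i, l2norm (b i) <= 1) -> l2norm lam <= RE -> l2norm lam' <= RE ->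
  \sum_i (gibbs q (fun i => dotp lam' (b i)) i
          - gibbs q (fun i => dotp lam (b i)) i) ^+ 2 <=
    rq * expR (2 * RE) / n%:R * l2norm (lam' - lam) ^+ 2.
Proof.
move=> b_le1 lamRE lam'RE.
have lineE : (fun i => dotp lam' (b i)) =
    (fun i => dotp lam (b i) + dotp (lam' - lam) (b i)).
  by apply/funext => i; rewrite -dotpDl addrC subrK.
rewrite lineE; apply: gibbs_lipschitz => // [t i t01|t t01].
  apply: gibbs_le_ball => {}i.
  by rewrite -dotp_line dotp_ball // l2norm_segment.
set xt := fun i => _ + _.
rewrite -[leRHS]mul1r -(sum_gibbs n_gt0 q_gt0 xt) mulr_suml ler_sum // => i _.
rewrite ler_wpM2l ?gibbs_ge0 // -real_normK ?num_real //.
by rewrite ler_pXn2r ?nnegrE ?l2norm_ge0 // dotp_ball.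
Qed.
End RegularizedDual.

(** * Entropy balancing *)

Lemma max_min_ratio_comparable (R : realType) n (q : 'I_n -> R) i j :
  probability_vector q -> q i <= max_min_ratio q * q j.
Proof.
case=> q_gt0 q_sum1.
have min_gt0 : 0 < \big[Num.min/1]_(l < n) q l by apply/bigmin_gtP.
rewrite /max_min_ratio mulrAC ler_pdivlMr // ler_pM ?(ltW (q_gt0 i)) ?(ltW min_gt0) //.
  exact: le_bigmax.
exact: bigmin_le.
Qed.

(** The quadratic form of the empirical covariance at [v] is the empirical variance of the numbers
    [dotp v (b i)]. *)
Lemma lambda_min_empirical_cov (R : realType) n m (b : 'I_n -> 'rV[R]_m) v :
  lambda_min (empirical_cov (\matrix_(i < n) b i)) * dotp v v <=
    n%:R^-1 * \sum_i (dotp v (b i) - n%:R^-1 * \sum_j dotp v (b j)) ^+ 2.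
Proof.
set B := \matrix_(i < n) b i.
have cov_sym : (empirical_cov B)^T = empirical_cov B.
  rewrite /empirical_cov linearZ /= linear_sum /=; congr (_ *: _).
  by apply: eq_bigr => i _; rewrite trmx_mul trmxK.
apply: le_trans (lambda_min_le_quadratic_form cov_sym v) _.
rewrite /empirical_cov -scalemxAr dotpZl mulmx_sumr dotpC dotp_sumr.
rewrite le_eqVlt; apply/orP; left; apply/eqP; congr (_ * _); apply: eq_bigr => i _.
have -> : rows_mean B = n%:R^-1 *: \sum_j b j.
  by rewrite /rows_mean; congr (_ *: _); apply: eq_bigr => j _; rewrite rowK.
rewrite rowK -dotp_sumr -dotpZr -dotpBr.
set z := b i - _.
have -> : v *m (z^T *m z) = dotp v z *: z.
  rewrite mulmxA; apply/rowP => j; rewrite !mxE big_ord1 !mxE; congr (_ * _).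
  by apply: eq_bigr => l _; rewrite !mxE.
by rewrite dotpZr expr2.
Qed.

(** * The entropy balancing dual in terms of the extended rows *)

Section Arms.
Variables (R : realType) (n p K : nat).
Variables (g : 'rV[R]_p -> 'rV[R]_K.+1) (D : dataset R n p).
Implicit Types (v : 'rV[R]_K.+1) (lam : 'rV[R]_(K.+1 + K.+1)) (a : bool).

Lemma dotp_row_mx lam (u v : 'rV[R]_K.+1) :
  dotp lam (row_mx u v) = dotp (lsubmx lam) u + dotp (rsubmx lam) v.
Proof.
rewrite /dotp big_split_ord; congr (_ + _); apply: eq_bigr => j _.
  by rewrite row_mxEl mxE.
by rewrite row_mxEr mxE.
Qed.

Lemma dotp_arm_embed lam a v : dotp lam (arm_embed a v) = dotp (arm_part a lam) v.
Proof. by case: a; rewrite dotp_row_mx dotp0r ?add0r ?addr0. Qed.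

Lemma arm_embedK a v : arm_part a (arm_embed a v) = v.
Proof. by case: a; rewrite /= ?row_mxKl ?row_mxKr. Qed.

Lemma l2norm_arm_embed a v : l2norm (arm_embed a v) = l2norm v.
Proof. by rewrite /l2norm dotp_arm_embed arm_embedK. Qed.

Lemma dotp_arm_embed_neq a a' u v : a != a' -> dotp (arm_embed a u) (arm_embed a' v) = 0.
Proof.
by rewrite dotp_arm_embed; case: a; case: a' => //= _; rewrite ?row_mxKl ?row_mxKr dotp0l.
Qed.

Lemma dotp_ext_row lam i :
  dotp lam (ext_row g D i) = arm_scale D i * dotp (arm_part (D i).2 lam) (g (D i).1).
Proof. by rewrite /ext_row dotpZr dotp_arm_embed. Qed.

Lemma ebw_C_partition_fun q lam :
  ebw_C g q D lam = partition_fun q (fun i => dotp lam (ext_row g D i)).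
Proof. by apply: eq_bigr => i _; rewrite dotp_ext_row. Qed.

Lemma ebw_weights_gibbs q lam i :
  ebw_weights g q D lam ord0 i = n%:R * gibbs q (fun i => dotp lam (ext_row g D i)) i.
Proof.
by rewrite mxE ebw_C_partition_fun /gibbs /tilt -dotp_ext_row mulrAC mulrA.
Qed.

(** The vector of the linear term of the dual: both arms are balanced towards the same overall
    mean. *)
Definition arm_target : 'rV[R]_(K.+1 + K.+1) := row_mx (g_mean g D) (g_mean g D).

Lemma ebw_objective_dual q lamE lam :
  ebw_objective g q lamE D lam = dual_objective q lamE (ext_row g D) arm_target lam.
Proof.
by rewrite /ebw_objective /dual_objective ebw_C_partition_fun dotp_row_mx dotpDl.
Qed.

Lemma ebw_argmax_dual q RE lamE lam :
  ebw_argmax g q RE lamE D lam -> dual_argmax q RE lamE (ext_row g D) arm_target lam.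
Proof.
by case=> lamRE lam_max; split=> // mu muRE; rewrite -!ebw_objective_dual lam_max.
Qed.

Hypothesis rows_le1 : forall i, l2norm (ext_row g D i) <= 1.
Hypothesis arm_ge1 : forall a, (1 <= arm_size D a)%N.

(** The normalization of the rows read backwards: the embedding is isometric, so only the factor
    [n / n_a] has to be undone. *)
Lemma l2norm_feature_le i :
  n%:R * l2norm (g (D i).1) <= (arm_size D (D i).2)%:R.
Proof.
have N_gt0 : 0 < (arm_size D (D i).2)%:R :> R by rewrite ltr0n arm_ge1.
have := rows_le1 i; rewrite /ext_row l2normZ l2norm_arm_embed ger0_norm.
  by rewrite /arm_scale mulrAC ler_pdivrMr // mul1r.
by rewrite divr_ge0.
Qed.

Lemma arm_size_le a : (arm_size D a <= n)%N.
Proof. by rewrite -[leqRHS]card_ord max_card. Qed.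

Lemma l2norm_row_mx_diag v : l2norm (row_mx v v) = Num.sqrt 2 * l2norm v.
Proof.
rewrite /l2norm dotp_row_mx row_mxKl row_mxKr -sqrtrM //.
by congr Num.sqrt; ring.
Qed.

Lemma l2norm_arm_target_le : l2norm arm_target <= Num.sqrt 2.
Proof.
rewrite l2norm_row_mx_diag -[leRHS]mulr1 ler_wpM2l ?sqrtr_ge0 //.
have n_gt0 : (0 < n)%N by rewrite (leq_trans (arm_ge1 true)) ?arm_size_le.
have nR_gt0 : 0 < n%:R :> R by rewrite ltr0n.
rewrite /g_mean l2normZ ger0_norm ?invr_ge0 // ler_pdivrMl // mulr1.
apply: le_trans (l2norm_sum _) _.
rewrite -[X in _ <= X%:R]card_ord -sumr_const ler_sum // => i _.
rewrite -(ler_pM2l nR_gt0) mulr1 (le_trans (l2norm_feature_le i)) //.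
by rewrite ler_nat arm_size_le.
Qed.
End Arms.

(** The difference of the factors is [(x / c) / (c + 1)] up to sign, and [(x / c) *: v] is one of
    the two vectors of norm at most one. *)
Lemma l2norm_rescale_consecutive (R : realType) m (v : 'rV[R]_m) (x : R) (N N' c : nat) :
  (0 < c)%N -> (N = c /\ N' = c.+1 \/ N = c.+1 /\ N' = c) ->
  0 <= x -> l2norm ((x / N%:R) *: v) <= 1 -> l2norm ((x / N'%:R) *: v) <= 1 ->
  l2norm ((x / N%:R) *: v - (x / N'%:R) *: v) <= c.+1%:R^-1.
Proof.
move=> c_gt0 NN' x_ge0 le1 le1'.
have cR_gt0 : 0 < c%:R :> R by rewrite ltr0n.
have c1R_gt0 : 0 < c.+1%:R :> R by rewrite ltr0n.
have c_le1 : l2norm ((x / c%:R) *: v) <= 1 by case: NN' => -[E E']; rewrite -?E // -E'.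
have diffE : x / c%:R - x / c.+1%:R = c.+1%:R^-1 * (x / c%:R).
  by rewrite -natr1; field; rewrite natr1 !pnatr_eq0 -lt0n c_gt0.
have -> : l2norm ((x / N%:R) *: v - (x / N'%:R) *: v) =
    l2norm ((x / c%:R - x / c.+1%:R) *: v).
  rewrite -scalerBl; case: NN' => -[-> ->] //.
  by rewrite -opprB scaleNr l2normN.
rewrite diffE -scalerA l2normZ ger0_norm ?invr_ge0 ?ler0n //.
by rewrite -[leRHS]mulr1 ler_wpM2l ?invr_ge0 ?ler0n.
Qed.

(** * Effect of one changed point on the rows and on the target *)

Section Neighbours.
Variables (R : realType) (n p K : nat) (g : 'rV[R]_p -> 'rV[R]_K.+1).
Variables (D D' : dataset R n p) (k : 'I_n).
Hypothesis agree : forall i, i != k -> D i = D' i.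
Hypothesis rows_le1 : forall i, l2norm (ext_row g D i) <= 1.
Hypothesis rows'_le1 : forall i, l2norm (ext_row g D' i) <= 1.
Hypothesis arm_ge1 : forall a, (1 <= arm_size D a)%N.
Hypothesis arm'_ge1 : forall a, (1 <= arm_size D' a)%N.

Let b := ext_row g D.
Let b' := ext_row g D'.
(** The size of arm [a] without the changed point, common to both datasets. *)
Let c a := #|[pred i | (i != k) && ((D i).2 == a)]|.

Let n_gt0 : (0 < n)%N.
Proof. by rewrite (leq_trans (arm_ge1 true)) ?arm_size_le. Qed.

Let nR_gt0 : 0 < n%:R :> R.
Proof. by rewrite ltr0n. Qed.

Let arm_sizeE a : arm_size D a = (((D k).2 == a) + c a)%N.
Proof.
by rewrite /arm_size (cardD1 k) !inE.
Qed.

Let arm_size'E a : arm_size D' a = (((D' k).2 == a) + c a)%N.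
Proof.
rewrite /arm_size (cardD1 k) !inE; congr (_ + _)%N; apply: eq_card => i.
by rewrite !inE; have [//|/agree->] := eqVneq i k.
Qed.

Let sum_c : (c true + c false)%N.+1 = n.
Proof.
rewrite -[RHS]card_ord (cardD1 k) inE add1n; congr _.+1.
rewrite -(cardID [pred i | (D i).2]); congr (_ + _)%N; apply: eq_card => i;
  by rewrite !inE; case: (D i).2; case: (i == k).
Qed.

(** Only the summand [k] of the mean changes. The arm sizes are kept because they add up to only
    [n + 1] when the point switches arms. *)
Lemma l2norm_arm_target_sub_le :
  l2norm (arm_target g D - arm_target g D') <= Num.sqrt 2 / n%:R ^+ 2 *
    ((arm_size D (D k).2)%:R + (arm_size D' (D' k).2)%:R).
Proof.
rewrite /arm_target opp_row_mx add_row_mx l2norm_row_mx_diag -mulrA.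
rewrite ler_wpM2l ?sqrtr_ge0 //.
have -> : g_mean g D - g_mean g D' = n%:R^-1 *: (g (D k).1 - g (D' k).1).
  rewrite /g_mean -scalerBr -sumrB (bigD1 k) //= big1 ?addr0 // => i /agree ->.
  by rewrite subrr.
rewrite l2normZ ger0_norm ?invr_ge0 // expr2 invfM -mulrA ler_wpM2l ?invr_ge0 //.
rewrite ler_pdivlMl //.
apply: le_trans (_ : n%:R * (l2norm (g (D k).1) + l2norm (g (D' k).1)) <= _).
  by rewrite ler_wpM2l // l2normB.
by rewrite mulrDr lerD // l2norm_feature_le.
Qed.

Section SameArm.
Hypothesis same_arm : (D k).2 = (D' k).2.

Let row_eq i : i != k -> b i = b' i.
Proof.
move=> i_neq; rewrite /b /b' /ext_row /arm_scale -(agree i_neq).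
by rewrite arm_sizeE arm_size'E same_arm.
Qed.

Let row_k : l2norm (b k - b' k) <= 2.
Proof. by rewrite (le_trans (l2normB _ _)) // -[leRHS]/(1 + 1) lerD. Qed.

Lemma same_arm_sum_l2norm : \sum_i l2norm (b i - b' i) <= 2.
Proof.
rewrite (bigD1 k) //= big1 ?addr0 // => i /row_eq ->.
by rewrite subrr l2norm0.
Qed.

Lemma same_arm_sum_sqr_l2norm : \sum_i l2norm (b i - b' i) ^+ 2 <= 4.
Proof.
rewrite (bigD1 k) //= big1 ?addr0 => [|i /row_eq ->]; last first.
  by rewrite subrr l2norm0 expr0n.
have -> : 4 = 2 ^+ 2 :> R by ring.
by rewrite ler_pXn2r ?nnegrE ?l2norm_ge0.
Qed.

Lemma same_arm_target : l2norm (arm_target g D - arm_target g D') <= 2 * Num.sqrt 2 / n%:R.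
Proof.
apply: le_trans l2norm_arm_target_sub_le _.
have -> : 2 * Num.sqrt 2 / n%:R = Num.sqrt 2 / n%:R ^+ 2 * (n%:R + n%:R) :> R.
  by field; rewrite gt_eqF.
by rewrite ler_wpM2l ?divr_ge0 ?sqrtr_ge0 ?exprn_ge0 // lerD // ler_nat arm_size_le.
Qed.
End SameArm.

Section DistinctArms.
Hypothesis distinct_arms : (D k).2 != (D' k).2.

(** In one of the two datasets the changed point lies outside arm [a], which is nonempty there. *)
Let c_gt0 a : (0 < c a)%N.
Proof.
have := arm_ge1 a; have := arm'_ge1 a; rewrite arm_sizeE arm_size'E.
move: distinct_arms.
by case: ((D k).2 =P a) => [->|_]; case: ((D' k).2 =P a) => [->|_]; rewrite ?eqxx.
Qed.

Let row_le i : i != k -> l2norm (b i - b' i) <= (c (D i).2).+1%:R^-1.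
Proof.
move=> i_neq.
have := rows_le1 i; have := rows'_le1 i.
rewrite /b /b' /ext_row /arm_scale -(agree i_neq) => le1' le1.
apply: l2norm_rescale_consecutive => //.
rewrite arm_sizeE arm_size'E; move: distinct_arms.
by case: (D k).2; case: (D' k).2; case: (D i).2 => //= _; [right|left|left|right].
Qed.

(** Each arm contributes [c / (c + 1) = 1 - 1 / (c + 1)], and [c + 1 <= n]. *)
Let sum_inv_c : \sum_(i | i != k) (c (D i).2).+1%:R^-1 <= 2 - 2 / n%:R :> R.
Proof.
have -> : \sum_(i | i != k) (c (D i).2).+1%:R^-1 =
    \sum_a (c a)%:R / (c a).+1%:R :> R.
  rewrite (partition_big (fun i => (D i).2) xpredT) //=; apply: eq_bigr => a _.
  rewrite (eq_bigr (fun=> (c a).+1%:R^-1)) => [|i /andP[_ /eqP->]//].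
  by rewrite sumr_const mulr_natl.
have term a : (c a)%:R / (c a).+1%:R <= 1 - n%:R^-1 :> R.
  have -> : (c a)%:R / (c a).+1%:R = 1 - (c a).+1%:R^-1 :> R.
    by rewrite -natr1; field; rewrite natr1 pnatr_eq0.
  rewrite lerD2l lerN2 lef_pV2 ?posrE ?ltr0n // ler_nat -sum_c.
  by case: a; lia.
have -> : 2 - 2 / n%:R = (1 - n%:R^-1) + (1 - n%:R^-1) :> R by ring.
by rewrite big_bool /= lerD.
Qed.

(** The two rows lie in orthogonal blocks, so their squared norms add. *)
Let row_k : l2norm (b k - b' k) ^+ 2 <= 2.
Proof.
have le1 (v : 'rV[R]_(K.+1 + K.+1)) : l2norm v <= 1 -> dotp v v <= 1.
  by move=> v1; rewrite -sqr_l2norm expr_le1 ?l2norm_ge0.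
have orth : dotp (b k) (b' k) = 0.
  by rewrite /b /b' /ext_row dotpZl dotpZr dotp_arm_embed_neq // !mulr0.
rewrite sqr_l2norm dotpBl !dotpBr (dotpC (b' k)) orth.
by have := le1 _ (rows_le1 k); have := le1 _ (rows'_le1 k); rewrite -/b -/b'; lra.
Qed.

Lemma distinct_arms_sum_l2norm :
  \sum_i l2norm (b i - b' i) <= Num.sqrt 2 + 2 - 2 / n%:R.
Proof.
rewrite (bigD1 k) //= -addrA lerD //.
  by rewrite -[leLHS]ger0_norm ?l2norm_ge0 // -sqrtr_sqr ler_wsqrtr.
by apply: le_trans sum_inv_c; exact: ler_sum.
Qed.

Lemma distinct_arms_sum_sqr_l2norm : \sum_i l2norm (b i - b' i) ^+ 2 <= 4.
Proof.
rewrite (bigD1 k) //=.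
have -> : 4 = 2 + 2 :> R by ring.
rewrite lerD //.
apply: le_trans (_ : 2 - 2 / n%:R <= _); last by rewrite lerBlDr lerDl divr_ge0.
apply: le_trans sum_inv_c; apply: ler_sum => i i_neq.
apply: le_trans (row_le i_neq).
(* The norm is at most one, so its square is no larger than the norm itself. *)
rewrite expr2 -[leRHS]mulr1 ler_wpM2l ?l2norm_ge0 //.
by rewrite (le_trans (row_le i_neq)) // invf_le1 ?ltr0n // ler1n.
Qed.

Lemma distinct_arms_target :
  l2norm (arm_target g D - arm_target g D') <= Num.sqrt 2 * (1 + n%:R^-1) / n%:R.
Proof.
apply: le_trans l2norm_arm_target_sub_le _.
rewrite arm_sizeE arm_size'E !eqxx -natrD.
have -> : (true + c (D k).2 + (true + c (D' k).2))%N = n.+1.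
  rewrite -sum_c; move: distinct_arms.
  by case: (D k).2; case: (D' k).2 => //= _;
    rewrite -/(c true) -/(c false) /nat_of_bool; move: (c true) (c false); lia.
rewrite le_eqVlt; apply/orP; left; apply/eqP.
by rewrite -natr1; field; rewrite gt_eqF.
Qed.
End DistinctArms.

Lemma neighbours_sum_sqr_l2norm : \sum_i l2norm (b i - b' i) ^+ 2 <= 4.
Proof.
have [same|distinct] := eqVneq (D k).2 (D' k).2.
  exact: same_arm_sum_sqr_l2norm.
exact: distinct_arms_sum_sqr_l2norm.
Qed.

Lemma neighbours_gap (M : R) : 1 <= M ->
  l2norm (arm_target g D - arm_target g D') + M / n%:R * \sum_i l2norm (b i - b' i) <=
    2 * Num.sqrt M * (Num.sqrt 2 + M) / n%:R.
Proof.
move=> M_ge1.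
have M_ge0 : 0 <= M by exact: le_trans ler01 M_ge1.
set r2 := Num.sqrt 2; set s := Num.sqrt M.
have r2_ge0 : 0 <= r2 by exact: sqrtr_ge0.
have r2_sqr : r2 ^+ 2 = 2 by rewrite sqr_sqrtr.
have s_ge1 : 1 <= s by rewrite -[leLHS]sqrtr1 ler_wsqrtr.
have s_sqr : s ^+ 2 = M by rewrite sqr_sqrtr.
have [same|distinct] := eqVneq (D k).2 (D' k).2.
  apply: le_trans (_ : 2 * r2 / n%:R + M / n%:R * 2 <= _).
    rewrite lerD ?same_arm_target // ler_wpM2l ?divr_ge0 //.
    exact: same_arm_sum_l2norm.
  (* In the same-arm case the factor [s >= 1] is slack. *)
  have -> : 2 * r2 / n%:R + M / n%:R * 2 = 1 * (2 * (r2 + M)) / n%:R by ring.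
  rewrite [2 * s]mulrC -[s * 2 * _]mulrA ler_wpM2r ?invr_ge0 //.
  by rewrite ler_wpM2r // mulr_ge0 // addr_ge0.
have inv_n_ge0 : 0 <= n%:R^-1 :> R by rewrite invr_ge0.
have r2_le2 : r2 <= 2 * M.
  (* This sign condition allows the correction of order [1 / n ^+ 2] to be dropped below. *)
  by rewrite -(@ler_pXn2r _ 2) ?nnegrE ?mulr_ge0 // r2_sqr; nra.
apply: le_trans (_ : r2 * (1 + n%:R^-1) / n%:R + M / n%:R * (r2 + 2 - 2 / n%:R) <= _).
  rewrite lerD ?distinct_arms_target // ler_wpM2l ?divr_ge0 //.
  exact: distinct_arms_sum_l2norm.
have -> : r2 * (1 + n%:R^-1) / n%:R + M / n%:R * (r2 + 2 - 2 / n%:R) =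
    (r2 + M * (r2 + 2) - n%:R^-1 * (2 * M - r2)) / n%:R by ring.
rewrite ler_wpM2r //.
apply: le_trans (_ : r2 + M * (r2 + 2) <= _).
  by rewrite gerBl mulr_ge0 // subr_ge0.
rewrite -subr_ge0 -s_sqr.
(* In [s], the square root of [M], the gap is a cubic with root [1]; the quadratic cofactor is
   positive. *)
have -> : 2 * s * (r2 + s ^+ 2) - (r2 + s ^+ 2 * (r2 + 2)) =
    (s - 1) * (2 * s ^+ 2 - r2 * s + r2) by ring.
rewrite mulr_ge0 ?subr_ge0 //.
by have := sqr_ge0 (2 * s - r2); nra.
Qed.
End Neighbours.

(** * From the dual estimates to the weights *)

Unset Implicit Arguments.

Theorem theorem4p9 (R : realType) (n p K : nat)
    (g : 'rV[R]_p -> 'rV[R]_K.+1) (q : 'I_n -> R) (RE lamE : R)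
    (D D' : dataset R n p) (lam lam' : 'rV[R]_(K.+1 + K.+1))
    (g0_const : constant_zeroth_moment g)
    (q_prob : probability_vector q)
    (lamE_ge0 : 0 <= lamE)
    (armD : forall a : bool, (1 <= arm_size D a)%N)
    (armD' : forall a : bool, (1 <= arm_size D' a)%N)
    (neighbours : differ_at_one_point D D')
    (rowsD : forall i : 'I_n, l2norm (ext_row g D i) <= 1)
    (rowsD' : forall i : 'I_n, l2norm (ext_row g D' i) <= 1)
    (lam_argmax : ebw_argmax g q RE lamE D lam)
    (lam'_argmax : ebw_argmax g q RE lamE D' lam') :
  let w := ebw_weights g q D lam in
  let w' := ebw_weights g q D' lam' in
  let rq := max_min_ratio q in
  let rho :=
    rq^-1 * expR (- 2 * RE) * lambda_min (empirical_cov (ext_mx g D)) + lamE in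
  let deltaE := Num.min RE ((1 + Num.sqrt 2) / rho) in
  0 < rho ->
  l2norm (w - w') <=
    2 * rq * expR (2 * RE) * (Num.sqrt 2 + rq * expR (2 * RE))
      / (rho * Num.sqrt n%:R)
    + 2 * RE * rq ^+ 2 * expR (4 * RE) / rho
    + 2 * Num.sqrt 2 * rq * deltaE * expR (2 * deltaE).
Proof.
move=> w w' rq rho deltaE rho_gt0.
have [k agree] := neighbours.
have [q_gt0 _] := q_prob.
have n_gt0 : (0 < n)%N by rewrite (leq_trans (armD true)) ?arm_size_le.
have nR_gt0 : 0 < n%:R :> R by rewrite ltr0n.
have q_comp i j : q i <= rq * q j by exact: max_min_ratio_comparable.
have rq_ge1 : 1 <= rq by exact: ratio_ge1 q_comp.
have rq_ge0 := le_trans ler01 rq_ge1.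
have dual_max := ebw_argmax_dual lam_argmax.
have dual_max' := ebw_argmax_dual lam'_argmax.
have [lamRE _] := lam_argmax; have [lam'RE _] := lam'_argmax.
have RE_ge0 := le_trans (l2norm_ge0 lam) lamRE.
have cov_ge := @lambda_min_empirical_cov _ _ _ (ext_row g D).
have sqr_le4 := neighbours_sum_sqr_l2norm agree rowsD rowsD' armD armD'.
set M := rq * expR (2 * RE).
have M_ge1 : 1 <= M.
  by rewrite -[leLHS]mulr1 ler_pM // -[leLHS]expR0 ler_expR mulr_ge0.
have M_ge0 := le_trans ler01 M_ge1.
pose P (E : dataset R n p) mu := gibbs q (fun i => dotp mu (ext_row g E i)).
(* The data change first, at [lam], the parameter whose norm is known to be at most [deltaE]; then
   [u'] changes the parameter on [D']. *)
pose u := \row_i (n%:R * (P D lam i - P D' lam i)).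
pose u' := \row_i (n%:R * (P D' lam i - P D' lam' i)).
have wE : w - w' = u' + u.
  apply/rowP => i; rewrite [LHS]mxE [X in _ + X]mxE !ebw_weights_gibbs.
  by rewrite [RHS]mxE !mxE /P; ring.
have l2norm_row (f : 'I_n -> R) (c : R) : 0 <= c ->
    \sum_i f i ^+ 2 <= c ^+ 2 -> l2norm (\row_i (n%:R * f i)) <= n%:R * c.
  move=> c_ge0 f_le.
  have -> : \row_i (n%:R * f i) = n%:R *: \row_i f i by apply/rowP => i; rewrite !mxE.
  rewrite l2normZ ger0_norm // ler_wpM2l // -(@ler_pXn2r _ 2) ?nnegrE ?l2norm_ge0 //.
  by rewrite sqr_l2norm /dotp; under eq_bigr do rewrite mxE -expr2.
have lam_deltaE : l2norm lam <= deltaE.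
  rewrite le_min lamRE ler_pdivlMr // mulrC.
  apply: le_trans (dual_norm_le n_gt0 q_gt0 q_comp rowsD cov_ge dual_max) _.
  (* The target has norm at most [Num.sqrt 2], whence the numerator [1 + Num.sqrt 2] of [deltaE]. *)
  by rewrite lerD2l l2norm_arm_target_le.
have deltaE_ge0 := le_trans (l2norm_ge0 lam) lam_deltaE.
have u_le : l2norm u <= 2 * Num.sqrt 2 * rq * deltaE * expR (2 * deltaE).
  have c_ge0 : 0 <= 2 * deltaE * (rq * expR (2 * deltaE)) / n%:R.
    rewrite divr_ge0 // mulr_ge0 //; first by rewrite mulr_ge0.
    by rewrite mulr_ge0 // expR_ge0.
  apply: le_trans (l2norm_row _ _ c_ge0 _) _.
    exact: gibbs_change_features.
  rewrite mulrC divfK ?gt_eqF //.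
  have -> : 2 * Num.sqrt 2 * rq * deltaE * expR (2 * deltaE) =
    Num.sqrt 2 * (2 * deltaE * (rq * expR (2 * deltaE))) by ring.
  (* The factor [Num.sqrt 2] is slack in this term. *)
  rewrite ler_peMl //; last first.
    by rewrite -[leLHS]sqrtr1 ler_wsqrtr // ler1n.
  rewrite mulr_ge0 //; first by rewrite mulr_ge0.
  by rewrite mulr_ge0 // expR_ge0.
set v := lam' - lam.
have sMn_ge0 : 0 <= Num.sqrt (M / n%:R) := sqrtr_ge0 _.
have v_le : rho * l2norm v <=
    2 * Num.sqrt M * (Num.sqrt 2 + M) / n%:R + 2 * RE * Num.sqrt (M / n%:R).
  have gap := neighbours_gap agree rowsD rowsD' armD armD' M_ge1.
  have stab := dual_stability n_gt0 q_gt0 q_comp rowsD cov_ge dual_max dual_max'.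
  have pert := dual_mean_perturbation n_gt0 q_gt0 q_comp v rowsD rowsD' lam'RE sqr_le4.
  (* Stability is quadratic in the norm of [v] and the gap linear, so one factor is cancelled when
     it is nonzero. *)
  have [v0|v_neq0] := eqVneq (l2norm v) 0.
    by rewrite v0 mulr0 addr_ge0 ?mulr_ge0 ?addr_ge0 ?invr_ge0 ?sqrtr_ge0.
  have v_gt0 : 0 < l2norm v by rewrite lt_def v_neq0 l2norm_ge0.
  rewrite -(ler_pM2l v_gt0) mulrCA -expr2.
  apply: le_trans stab _.
  have target := dotp_le v (- (arm_target g D - arm_target g D')).
  rewrite dotpNr l2normN in target.
  apply: le_trans (lerD pert target) _.
  rewrite -mulrDr ler_wpM2l ?l2norm_ge0 // addrAC lerD2r.
  by rewrite addrC.
have u'_le : l2norm u' <= n%:R * (Num.sqrt (M / n%:R) * l2norm v).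
  apply: l2norm_row; first by rewrite mulr_ge0 ?l2norm_ge0.
  (* Here [lam] is the end point and [lam'] the start, so [v] is reversed. *)
  rewrite exprMn sqr_sqrtr ?divr_ge0 // -[v]opprK l2normN /v opprB.
  exact: gibbs_change_parameter.
rewrite wE; apply: le_trans (l2normD _ _) _; rewrite lerD //.
apply: le_trans u'_le _.
set sM := Num.sqrt M in v_le *; set sn := Num.sqrt n%:R.
have sn_gt0 : 0 < sn by rewrite sqrtr_gt0.
have sM_sqr : M = sM ^+ 2 by rewrite sqr_sqrtr.
have sn_sqr : n%:R = sn ^+ 2 by rewrite sqr_sqrtr.
have sMnE : Num.sqrt (M / n%:R) = sM / sn by rewrite sqrtrM // sqrtrV.
have expE : rq ^+ 2 * expR (4 * RE) = M ^+ 2.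
  have -> : 4 * RE = 2 * RE + 2 * RE by ring.
  by rewrite expRD /M; ring.
apply: le_trans (_ : n%:R * (Num.sqrt (M / n%:R) *
    ((2 * sM * (Num.sqrt 2 + M) / n%:R + 2 * RE * Num.sqrt (M / n%:R)) / rho)) <= _).
  by rewrite !ler_wpM2l // ler_pdivlMr // mulrC.
rewrite -!(mulrA _ rq) -/M -(mulrA (2 * RE)) expE sMnE.
apply: le_trans (_ : 2 * M * (Num.sqrt 2 + M) / (rho * sn) + 2 * RE * M / rho <= _).
  rewrite sn_sqr sM_sqr le_eqVlt.
  by apply/orP; left; apply/eqP; field; rewrite !gt_eqF.
(* The second term comes out with [M]; [M >= 1] enlarges it to [M ^+ 2]. *)
rewrite lerD2l ler_wpM2r ?invr_ge0 ?(ltW rho_gt0) // ler_wpM2l ?mulr_ge0 //.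
by rewrite expr2 ler_peMl.
Qed.
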